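(* Let $G$ be a graph and let $L(G)$ be its graph Laplacian (with all edge weights equal to $1$). Then every eigenvalue of $L(G)$ is either an integer or an irrational number.
   Context: A graph $G(V,E)$ has a finite vertex set $V$ of cardinality $n$ and a finite edge set $E$, is connected, and has no loops and no multiple edges. Its graph Laplacian $L=L(G)$ is the $n\times n$ real symmetric matrix with $L_{ij}=-1$ if $i\neq j$ and the edge $ij$ exists, $L_{ij}=0$ if $i\neq j$ and it does not, and $L_{ii}$ equal to the degree of vertex $i$. All eigenvalues of $L$ are real. *)

(* Defs.v *)
From mathcomp Require Import all_boot all_order all_algebra.
From mathcomp Require Import all_classical all_reals.

Set Implicit Arguments.
Unset Strict Implicit.
Unset Printing Implicit Defensive.

Import GRing.Theory Num.Theory.
Local Open Scope ring_scope.

(* The edge set is the adjacency relation [adj]: symmetry makes edges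
   unordered pairs, irreflexivity excludes loops, and a relation has no
   multiple edges. *)
Record graph_axioms (V : finType) (adj : rel V) : Prop := GraphAxioms {
  adj_sym : symmetric adj;
  adj_irrefl : irreflexive adj;
  adj_connected : forall x y : V, connect adj x y
}.

Definition degree (V : finType) (adj : rel V) (x : V) : nat :=
  #|[set y | adj x y]|.

(* Rows and columns are numbered by the enumeration of V, so the matrix
   size is n = #|V|. *)
Definition laplacian (R : pzRingType) (V : finType) (adj : rel V)
    : 'M[R]_#|V| :=
  \matrix_(i, j)
    if i == j then (degree adj (enum_val i))%:R
    else if adj (enum_val i) (enum_val j) then -1 else 0.

(* Main.v *)
Require Import Defs.
From mathcomp Require Import all_boot all_order all_algebra.
From mathcomp Require Import all_classical all_reals.
Import GRing.Theory Num.Theory.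
Local Open Scope ring_scope.

(** The Laplacian has integer entries, so its characteristic polynomial is the
    image of a monic polynomial over the integers, and every eigenvalue is an
    algebraic integer ([eigenvalue_map_int_mx]). The integers are integrally
    closed in the rationals ([rat_integral_int]), so an eigenvalue that is
    rational is an integer. *)

(** By Gauss's lemma, a rational root [x] of a monic integer polynomial [p]
    gives a factor of [p] with integer coefficients that is proportional to
    ['X - x]; its leading coefficient divides that of [p], hence is a unit, so
    rescaling this factor to ['X - x] keeps its coefficients integral. *)
Lemma rat_integral_int (x : rat) :
  integralOver (intr : int -> rat) x -> x \is a Num.int.
Proof.
case=> p p_mon; rewrite root_factor_theorem => /dvdpP_rat_int.
case=> q [a a_neq0 Dq] [r Dp].
have size_q : size q = 2.
  by rewrite -(size_rat_int_poly q) -(size_scale _ a_neq0) -Dq size_XsubC.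
have lead_qr : q`_1 * lead_coef r = 1.
  by rewrite -(monicP p_mon) Dp lead_coefM {2}/lead_coef size_q.
have aq1 : a * (q`_1)%:~R = 1.
  by rewrite -[LHS]/(a * intr q`_1) -coef_map -coefZ -Dq coefB coefX coefC /= subr0.
(* Both [a] and [lead_coef r] are inverses of the leading coefficient of [q]. *)
have Da : a = (lead_coef r)%:~R.
  by rewrite -[a]mulr1 -[X in a * X](rmorph1 intr) -lead_qr rmorphM /= mulrA aq1 mul1r.
have Dx : - x = a * (q`_0)%:~R.
  by rewrite -[RHS]/(a * intr q`_0) -coef_map -coefZ -Dq coefB coefX coefC /= sub0r.
by rewrite -[x]opprK Dx Da -rmorphM -rmorphN; apply: intr_int.
Qed.

Lemma eigenvalue_map_int_mx (F : fieldType) (n : nat) (A : 'M[int]_n) (a : F) :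
  eigenvalue (map_mx intr A) a -> integralOver intr a.
Proof.
rewrite eigenvalue_root_char -map_char_poly => root_a.
by exists (char_poly A); first exact: char_poly_monic.
Qed.

Lemma map_laplacian (R S : pzRingType) (f : {rmorphism R -> S})
    (V : finType) (adj : rel V) :
  map_mx f (laplacian R adj) = laplacian S adj.
Proof.
apply/matrixP=> i j; rewrite !mxE; case: ifP => _; first exact: rmorph_nat.
by case: ifP => _; rewrite ?rmorphN1 ?rmorph0.
Qed.

Theorem theorem2p10 (R : realType) (V : finType) (adj : rel V)
  (hG : graph_axioms adj) (lambda : R)
  (hlambda : eigenvalue (laplacian R adj) lambda) :
  lambda \is a Num.int \/ irrational lambda.
Proof.
have [[x _ Dlambda]|] := pselect (rational lambda); last by right.
left; move: hlambda; rewrite -Dlambda -(map_laplacian int R intr).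
case/eigenvalue_map_int_mx => p p_mon root_p.
have /intrP[m ->] : x \is a Num.int; last by rewrite ratr_int.
apply: rat_integral_int; exists p => //.
(* Evaluation at [x] may be tested after the embedding [ratr], under which
   integer coefficients keep their value. *)
rewrite -(fmorph_root (@ratr R)) -map_poly_comp.
by rewrite (eq_map_poly (g := intr)) // => m /=; rewrite ratr_int.
Qed.
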